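(* For every normed BPA system $\mathcal{G}=(V,\mathit{Act},\mathcal{R})$ (with $V$ linearly ordered), the canonical transducer $\mathcal{T}^\mathcal{G}$ is an nfc-transducer that is consistent with $\mathcal{G}$.
   Context: BPA system $\mathcal{G}=(V,\mathit{Act},\mathcal{R})$: finite variables $V$, finite actions (possibly with silent $\tau$), rules $A\xrightarrow{a}\alpha$; LTS $\mathcal{L}_\mathcal{G}$ on $V^*$ with $A\beta\xrightarrow{a}\alpha\beta$. Normed: each variable can reach $\varepsilon$. $\sim$: branching bisimilarity in $\mathcal{L}_\mathcal{G}$ (largest relation $\mathcal{B}$ such that for $(s,t)\in\mathcal{B}$ every move $s\xrightarrow{a}s'$ is matched by $a=\tau,(s',t)\in\mathcal{B}$, or by $t=t_0\xrightarrow{\tau}\cdots\xrightarrow{\tau}t_k\xrightarrow{a}t'$ with $(s',t')\in\mathcal{B}$, $(s,t_i)\in\mathcal{B}$, $i\in[1,k]$; and symmetrically). Transducer $\mathcal{T}=(Q,V,\Delta,q_0)$, $\Delta:Q\times V\to Q\times V^*$, read right to left: $q'\xleftarrow{A/\gamma}q$ means $\Delta(q,A)=(q',\gamma)$; extended by $q\xleftarrow{\varepsilon/\varepsilon}q$ and: $q'\xleftarrow{A/\gamma}q$, $q''\xleftarrow{\alpha/\beta}q'$ give $q''\xleftarrow{\alpha A/\beta\gamma}q$. $\mathcal{T}_q(\alpha)$ = output from $q$ on $\alpha$. $q$-normal form: $\varepsilon$ or $A_k\cdots A_1$ with $q_k\xleftarrow{A_k/A_k}\cdots q_1\xleftarrow{A_1/A_1}q$.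 nfc-transducer: each $\mathcal{T}_q(A)$ is a $q$-normal form and $q'\xleftarrow{A/\gamma}q$ implies $q'\xleftarrow{\gamma/\gamma}q$. Long moves: $\alpha\overset{a}{\Rightarrow}_q\beta$ if $a=\tau$ and $\beta=\mathcal{T}_q(\alpha)$, or $\alpha=\alpha_0\xrightarrow{\tau}\cdots\xrightarrow{\tau}\alpha_k\xrightarrow{a}\beta'$ in $\mathcal{L}_\mathcal{G}$ with $\mathcal{T}_q(\alpha_0)=\cdots=\mathcal{T}_q(\alpha_k)$, $\mathcal{T}_q(\beta')=\beta$. $\alpha_1\approx_q\alpha_2$ iff for each $a$ the sets of long-move results from $\alpha_1,\alpha_2$ coincide. Consistency with $\mathcal{G}$: (1) $A\approx_{q_0}\varepsilon$ if $\mathcal{T}_{q_0}(A)=\varepsilon$; (2) $A\approx_q\mathcal{T}_q(A)$ if $\mathcal{T}_q(A)\ne\varepsilon$; (3) $AC\approx_qC$ if $\mathcal{T}_q(AC)=\mathcal{T}_q(C)=C$. Canonical transducer: $R_\gamma=\{X\in V\mid X\gamma\sim\gamma\}$; prefix $\alpha$ of $\alpha\gamma$ is redundancy-free if not of the form $\delta X\beta$ with $X\beta\gamma\sim\beta\gamma$; $\alpha$ is lexicographically smaller than $\beta$ if $\alpha$ is a proper suffix of $\beta$ or $\alpha=\alpha'A\gamma,\beta=\beta'B\gamma$ with $A<B$. $\mathcal{T}^\mathcal{G}=(Q,V,\Delta,q_0)$ with $Q=\{R_\gamma\mid\gamma\in V^*\}$, $q_0=R_\varepsilon$, $\Delta(R_\gamma,A)=(R_{A\gamma},\alpha)$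 where $\alpha$ is lexicographically smallest among the longest strings with $\alpha\gamma\sim A\gamma$ and $\alpha$ a redundancy-free prefix of $\alpha\gamma$ (this is well defined: it depends only on $R_\gamma$). *)

(* Defs.v *)
From HB Require Import structures.
From mathcomp Require Import all_boot all_order.
From Stdlib Require Import Relations ClassicalEpsilon.
Set Implicit Arguments.
Unset Strict Implicit.
Unset Printing Implicit Defensive.

Definition pbool (P : Prop) : bool :=
  if excluded_middle_informative P then true else false.

Section BPA.
Variables (V : finType) (Act : finType) (tau : Act).
(* rules A -a-> alpha, as a finite list of triples (A, a, alpha) *)
Variable (R : seq (V * Act * seq V)).

Definition step (s : seq V) (a : Act) (t : seq V) : Prop :=
  exists A beta alpha, s = A :: beta /\ (A, a, alpha) \in R /\ t = alpha ++ beta.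

Definition anystep (s t : seq V) : Prop := exists a, step s a t.

Definition normed : Prop :=
  forall A : V, clos_refl_trans (seq V) anystep [:: A] [::].

Fixpoint taupath (t : seq V) (ts : seq (seq V)) : Prop :=
  match ts with
  | [::] => True
  | u :: ts' => step t tau u /\ taupath u ts'
  end.

Definition bb_half (B : seq V -> seq V -> Prop) : Prop :=
  forall s t, B s t -> forall a s', step s a s' ->
    (a = tau /\ B s' t) \/
    (exists (ts : seq (seq V)) t',
        taupath t ts /\ step (last t ts) a t' /\ B s' t' /\
        (forall u, u \in ts -> B s u)).

Definition branching_bisim (B : seq V -> seq V -> Prop) : Prop :=
  bb_half B /\ bb_half (fun x y => B y x).

Definition bisimilar (s t : seq V) : Prop :=
  exists B, branching_bisim B /\ B s t.

Section Transducer.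
Variables (Q : Type) (delta : Q -> V -> Q * seq V).

Definition run (q : Q) (w : seq V) : Q * seq V :=
  foldr (fun A p => let r := delta p.1 A in (r.1, r.2 ++ p.2)) (q, [::]) w.

Definition Tout (q : Q) (w : seq V) : seq V := (run q w).2.

Definition is_nf (q : Q) (w : seq V) : bool :=
  (foldr (fun A p => let r := delta p.1 A in (r.1, p.2 && (r.2 == [:: A])))
         (q, true) w).2.

Definition nfc : Prop :=
  forall (q : Q) (A : V),
    is_nf q (Tout q [:: A]) /\
    (forall q' gamma, delta q A = (q', gamma) -> run q gamma = (q', gamma)).

Definition long_move (q : Q) (alpha : seq V) (a : Act) (beta : seq V) : Prop :=
  (a = tau /\ beta = Tout q alpha) \/
  (exists (als : seq (seq V)) beta',
      taupath alpha als /\ (forall u, u \in als -> Tout q u = Tout q alpha) /\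
      step (last alpha als) a beta' /\ Tout q beta' = beta).

Definition approx (q : Q) (a1 a2 : seq V) : Prop :=
  forall a beta, long_move q a1 a beta <-> long_move q a2 a beta.

Definition consistent (q0 : Q) : Prop :=
  (forall A : V, Tout q0 [:: A] = [::] -> approx q0 [:: A] [::]) /\
  (forall (q : Q) (A : V), Tout q [:: A] <> [::] -> approx q [:: A] (Tout q [:: A])) /\
  (forall (q : Q) (A C : V), Tout q [:: A; C] = [:: C] -> Tout q [:: C] = [:: C] ->
      approx q [:: A; C] [:: C]).
End Transducer.
End BPA.

Section Canonical.
Variables (d : Order.disp_t) (V : finOrderType d) (Act : finType) (tau : Act).
Variable (R : seq (V * Act * seq V)).

Local Notation sim := (bisimilar tau R).

Definition Rset (gamma : seq V) : {set V} :=
  [set X | pbool (sim (X :: gamma) gamma)].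

Definition redfree (alpha gamma : seq V) : Prop :=
  ~ (exists delta (X : V) beta,
        alpha = delta ++ X :: beta /\ sim (X :: beta ++ gamma) (beta ++ gamma)).

Definition lexlt (alpha beta : seq V) : Prop :=
  (size alpha < size beta /\ suffix alpha beta) \/
  (exists alpha' beta' gamma (A B : V),
      alpha = alpha' ++ A :: gamma /\ beta = beta' ++ B :: gamma /\ (A < B)%O).

Definition cand (gamma : seq V) (A : V) (alpha : seq V) : Prop :=
  sim (alpha ++ gamma) (A :: gamma) /\ redfree alpha gamma.

Definition best (gamma : seq V) (A : V) (alpha : seq V) : Prop :=
  cand gamma A alpha /\
  (forall beta, cand gamma A beta -> size beta <= size alpha) /\
  (forall beta, cand gamma A beta -> size beta = size alpha -> beta <> alpha ->
      lexlt alpha beta).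

Definition canon_out (gamma : seq V) (A : V) : seq V :=
  match excluded_middle_informative (exists alpha, best gamma A alpha) with
  | left h => proj1_sig (constructive_indefinite_description _ h)
  | right _ => [::]
  end.

Definition QC : Type := {S : {set V} | exists gamma, S = Rset gamma}.

Definition mkQ (gamma : seq V) : QC := exist _ (Rset gamma) (ex_intro _ gamma erefl).

Definition rep (q : QC) : seq V :=
  proj1_sig (constructive_indefinite_description _ (proj2_sig q)).

Definition deltaC (q : QC) (A : V) : QC * seq V :=
  (mkQ (A :: rep q), canon_out (rep q) A).

Definition q0C : QC := mkQ [::].
End Canonical.

Arguments deltaC {d V Act} tau R q A.
Arguments QC {d V Act} tau R.

(* Main.v *)
(* Branching bisimilarity is preserved by prepending, and counting only the moves that are
   not silent moves inside a class gives a bisimulation-invariant norm that is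
   monotone under prepending. Hence s u ~ u iff every letter of s lies in
   R_u, and whether s u ~ t u holds depends on u only through R_u. The norm also
   bounds the length of redundancy-free strings, so the outputs of the canonical
   transducer exist, and any factor of such an output is left unchanged in the
   state where it is read. Normal forms are unique up to bisimilarity above the
   state, so T_q(s) = T_q(t) iff s u ~ t u, where u represents q; a bisimulation
   match of a move above u is then exactly a long move, provided it never
   descends into u, which it cannot do unless s u ~ u or u is empty. *)
From mathcomp Require Import all_boot all_order.
From Stdlib Require Import Relations ClassicalEpsilon ProofIrrelevance.
Require Import Defs.
Set Implicit Arguments.
Unset Strict Implicit.
Unset Printing Implicit Defensive.

Lemma pboolP (P : Prop) : reflect P (pbool P).
Proof. by rewrite /pbool; case: excluded_middle_informative => h; constructor. Qed.

(** * Branching bisimilarity as an equivalence preserved by prepending *)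

Section BranchingBisimilarity.
Variables (V Act : finType) (tau : Act) (R : seq (V * Act * seq V)).
Implicit Types (s t u : seq V) (ts us : seq (seq V)) (B : seq V -> seq V -> Prop).

Local Notation step := (step R).
Local Notation taupath := (taupath tau R).
Local Notation sim := (bisimilar tau R).

Definition matched B s t a s' : Prop :=
  (a = tau /\ B s' t) \/
  (exists ts t', taupath t ts /\ step (last t ts) a t' /\ B s' t' /\
                 (forall u, u \in ts -> B s u)).

Lemma matched_mono B1 B2 s t a s' :
  matched B1 s t a s' -> (forall x y, B1 x y -> B2 x y) -> matched B2 s t a s'.
Proof.
move=> + sub; case=> [[-> h]|[ts [t' [p [st [h hs]]]]]]; first by left; split; auto.
by right; exists ts, t'; do !split=> //; auto.
Qed.

Lemma matched_step B s t a s' t' : step t a t' -> B s' t' -> matched B s t a s'.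
Proof. by move=> st h; right; exists [::], t'. Qed.

Lemma step_cat s a t u : step s a t -> step (s ++ u) a (t ++ u).
Proof.
by case=> A [b [r [-> [inR ->]]]]; exists A, (b ++ u), r; rewrite catA.
Qed.

(** The premise keeps the move from being one of [u]: a nonempty [s] supplies the head letter, and
    if both strings are empty there is no move. *)
Lemma step_catI s a t u :
  step (s ++ u) a t -> (s = [::] -> u = [::]) ->
  exists2 s', step s a s' & t = s' ++ u.
Proof.
case: s => [|X s] [A [b [r [e [inR ->]]]]] h; first by rewrite h in e.
by case: e inR => -> <- inR; exists (r ++ s); [exists A, s, r|rewrite catA].
Qed.

Lemma step_nil a t : ~ step [::] a t.
Proof. by case=> A [b [r []]]. Qed.

Lemma taupath_catE t ts us :
  taupath t (ts ++ us) <-> taupath t ts /\ taupath (last t ts) us.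
Proof.
elim: ts t => [|x ts IH] t /=; first by split=> [|[]].
by rewrite IH; tauto.
Qed.

Lemma taupath_cat t ts u :
  taupath t ts -> taupath (t ++ u) [seq x ++ u | x <- ts].
Proof.
by elim: ts t => //= x ts IH t [st /IH h]; split=> //; apply: step_cat.
Qed.

(** A path from [s ++ u] can touch the letters of [u] only after visiting [u] itself, so without
    that visit the whole path lifts off [u]. *)
Lemma taupath_catI s u ts a t :
  taupath (s ++ u) ts -> step (last (s ++ u) ts) a t ->
  (u \in (s ++ u) :: ts -> u = [::]) ->
  exists us s', [/\ ts = [seq x ++ u | x <- us], taupath s us,
                    step (last s us) a s' & t = s' ++ u].
Proof.
elim: ts s => [|x ts IH] s /= p st hu.
  case: (step_catI st) => [se|s' st' ->]; last by exists [::], s'.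
  by apply: hu; rewrite se inE eqxx.
case: p => st1 p; case: (step_catI st1) => [se|s1 st1' ex].
  by apply: hu; rewrite se inE eqxx.
rewrite {}ex in st p hu st1 *.
have [|us [s' [-> p' st' ->]]] := IH s1 p st.
  by move=> h; apply: hu; rewrite inE h orbT.
by exists (s1 :: us), s'.
Qed.

Lemma sim_coind B s t :
  (forall x y, B x y -> B y x) -> bb_half tau R B -> B s t -> sim s t.
Proof.
move=> symB hB st; exists B; split=> //; split=> // x y /symB /hB h a x' /h m.
by apply: (@matched_mono B (fun u v => B v u) _ _ _ _ m) => ? ?; apply: symB.
Qed.

Lemma sim_half : bb_half tau R sim.
Proof.
move=> s t [B [bB st]] a s' /(bB.1 _ _ st) m.
by apply: (@matched_mono B sim _ _ _ _ m) => x y xy; exists B.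
Qed.

Lemma sim_sym s t : sim s t -> sim t s.
Proof. by case=> B [[h1 h2] st]; exists (fun x y => B y x). Qed.

Lemma sim_refl s : sim s s.
Proof.
apply: (@sim_coind eq) => // x _ <- a x' st.
exact: matched_step st _.
Qed.

Definition rel_comp B1 B2 s t : Prop := exists2 u, B1 s u & B2 u t.

(** The matches of the single silent moves are concatenated; their nodes stay related to [s] because
    [u] and all nodes of [us] are. *)
Lemma taupath_match B1 B2 s u t us :
  bb_half tau R B2 -> taupath u us -> B1 s u -> B2 u t ->
  (forall x, x \in us -> B1 s x) ->
  exists ts, [/\ taupath t ts, B2 (last u us) (last t ts) &
                 forall x, x \in ts -> rel_comp B1 B2 s x].
Proof.
move=> h2; elim: us u t => [|u1 us IH] u t /=; first by move=> _ _ ut _; exists [::].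
case=> st p su ut hs.
have su1 : B1 s u1 by apply: hs; rewrite inE eqxx.
have hs1 x : x \in us -> B1 s x by move=> xus; apply: hs; rewrite inE xus orbT.
case: (h2 _ _ ut _ _ st) => [[_ u1t]|[ts [t1 [pt [st1 [u1t1 hts]]]]]].
  exact: (IH u1 t).
have [ts' [p' l' hs']] := IH u1 t1 p su1 u1t1 hs1.
exists (ts ++ t1 :: ts'); split; first by apply/taupath_catE.
  by rewrite last_cat.
move=> x; rewrite mem_cat inE => /or3P[/hts h|/eqP->|/hs' //]; by [exists u|exists u1].
Qed.

(* If the last move of the intermediate process is absorbed on the right, the
   final silent step already made there plays the role of the matching move. *)
Lemma bb_half_comp B1 B2 :
  bb_half tau R B1 -> bb_half tau R B2 -> bb_half tau R (rel_comp B1 B2).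
Proof.
move=> h1 h2 s t [u su ut] a s' st.
case: (h1 _ _ su _ _ st) => [[-> s'u]|[us [u' [p [stu [s'u' hs]]]]]].
  by left; split=> //; exists u.
have [ts [pt lt hts]] := taupath_match h2 p su ut hs.
case: (h2 _ _ lt _ _ stu) => [[-> u't]|[ts2 [t' [p2 [st2 [u't' hs2]]]]]].
  case: (lastP ts) pt u't hts => [|ts' x] /= pt u't hts.
    by left; split=> //; exists u'.
  right; exists ts', x; move: pt u't; rewrite -cats1 last_cat => /taupath_catE [p1 [st1 _]] u't.
  do !split=> //; first by exists u'.
  by move=> y yts; apply: hts; rewrite mem_rcons inE yts orbT.
right; exists (ts ++ ts2), t'; do !split.
- by apply/taupath_catE.
- by rewrite last_cat.
- by exists u'.
move=> x; rewrite mem_cat => /orP[/hts //|/hs2 h].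
exists (last u us) => //.
by have := mem_last u us; rewrite inE => /orP[/eqP->//|/hs].
Qed.

Lemma sim_trans s t u : sim s t -> sim t u -> sim s u.
Proof.
move=> st tu; apply: (@sim_coind (rel_comp sim sim)); last by exists t.
  by move=> x y [z /sim_sym xz /sim_sym zy]; exists z.
by apply: bb_half_comp; apply: sim_half.
Qed.

Lemma sim_catl u s t : sim s t -> sim (u ++ s) (u ++ t).
Proof.
move=> st; pose B x y := exists u s t, [/\ x = u ++ s, y = u ++ t & sim s t].
apply: (@sim_coind B); last by exists u, s, t.
  by move=> _ _ [w [x [y [-> -> /sim_sym xy]]]]; exists w, y, x.
move=> _ _ [[|X w] [x [y [-> -> xy]]]] a z stz.
  apply: (@matched_mono sim B _ _ _ _ (sim_half xy stz)) => x' y' xy'.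
  by exists [::], x', y'.
case: (@step_catI (X :: w) a z x) => // w' st' ->.
apply: (@matched_step B _ _ _ _ _ (step_cat y st')).
by exists w', x, y.
Qed.

Lemma sim_cons X s t : sim s t -> sim (X :: s) (X :: t).
Proof. exact: (@sim_catl [:: X]). Qed.

(** * A norm that counts only moves that are not inert *)

Hypothesis Rnormed : normed R.


(* [walk n s t]: a path from s to t with at most n moves that are not inert,
   i.e. not silent moves inside a bisimilarity class. *)
Inductive walk : nat -> seq V -> seq V -> Prop :=
| walk_refl n s : walk n s s
| walk_inert n s u t : step s tau u -> sim s u -> walk n u t -> walk n s t
| walk_step n s a u t : step s a u -> walk n u t -> walk n.+1 s t.

Lemma walk_trans m n s t u : walk m s t -> walk n t u -> walk (m + n) s u.
Proof.
move=> w; elim: m s t / w n => [m s|m s v t st e _ IH|m s a v t st _ IH] n w.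
- by elim: n s u / w => [n s|n s v u st e _ w|n s a v u st _ w];
    [apply: walk_refl|apply: walk_inert st e w|rewrite addnS; apply: walk_step st w].
- exact: walk_inert st e (IH _ w).
- by rewrite addSn; apply: walk_step st (IH _ w).
Qed.

Lemma walk_taupath n s ts :
  taupath s ts -> (forall u, u \in ts -> sim s u) -> walk n s (last s ts).
Proof.
elim: ts s => [|x ts IH] s /=; first by move=> _ _; apply: walk_refl.
case=> st p hs.
have sx : sim s x by apply: hs; rewrite inE eqxx.
apply: (walk_inert st sx); apply: (IH _ p) => u uts.
by apply: (sim_trans (sim_sym sx)); apply: hs; rewrite inE uts orbT.
Qed.

Lemma walk0_sim s t : walk 0 s t -> sim s t.
Proof.
suff h n : walk n s t -> n = 0 -> sim s t by move=> w; apply: h w _.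
elim=> // [? ? _|? ? ? ? _ su _ IH e]; first exact: sim_refl.
exact: sim_trans su (IH e).
Qed.

(** A move absorbed on the other side costs nothing there; otherwise its match is a silent path
    inside the class, hence inert, followed by one counted move. *)
Lemma walk_sim n s t u : sim s u -> walk n s t -> exists2 u', walk n u u' & sim t u'.
Proof.
move=> su w; elim: n s t / w u su => [n s|n s v t st sv _ IH|n s a v t st _ IH] u su.
- by exists u => //; apply: walk_refl.
- by apply: IH; apply: sim_trans (sim_sym sv) su.
case: (sim_half su st) => [[_ /IH[u' w h]]|[ts [u1 [p [st1 [vu1 hs]]]]]].
  by exists u' => //; apply: (walk_trans (walk_refl 1 u) w).
have [u' w h] := IH _ vu1; exists u' => //.
rewrite -[n.+1]add0n; apply: (walk_trans (walk_taupath 0 p _) (walk_step st1 w)).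
by move=> x /hs; apply: sim_trans (sim_sym su).
Qed.

Lemma walk_normed s u : exists n, walk n (s ++ u) u.
Proof.
elim: s => [|A s [n w]]; first by exists 0; apply: walk_refl.
suff [m wm]: exists m, walk m ([:: A] ++ (s ++ u)) ([::] ++ (s ++ u)).
  by exists (m + n); apply: walk_trans wm w.
suff h x y : clos_refl_trans_1n _ (anystep R) x y ->
    exists m, walk m (x ++ (s ++ u)) (y ++ (s ++ u)).
  by apply/h/clos_rt_rt1n_iff/Rnormed.
elim=> {x y} [x|x y z [a st] _ [m w1]]; first by exists 0; apply: walk_refl.
by exists m.+1; apply: walk_step w1; apply: step_cat st.
Qed.

Lemma walk_nil_ex s : exists n, pbool (walk n s [::]).
Proof. by have [n w] := walk_normed s [::]; exists n; apply/pboolP; rewrite cats0 in w. Qed.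

Definition norm s : nat := ex_minn (walk_nil_ex s).

Lemma norm_walk s : walk (norm s) s [::].
Proof. by rewrite /norm; case: ex_minnP => n /pboolP. Qed.

Lemma norm_min n s : walk n s [::] -> norm s <= n.
Proof. by move=> /pboolP w; rewrite /norm; case: ex_minnP => m _; apply. Qed.

Lemma norm_le_walk n s t : walk n s t -> norm s <= n + norm t.
Proof. by move=> w; apply/norm_min/(walk_trans w)/norm_walk. Qed.

(* The empty process has no moves, so every process reachable from one
   bisimilar to it is reached by inert moves only. *)
Lemma walk_of_sim_nil s : sim s [::] -> walk 0 s [::].
Proof.
suff h n t : walk n s t -> t = [::] -> sim s [::] -> walk 0 s [::].
  have [n] := walk_normed s [::]; rewrite cats0 => w.
  exact: h w (erefl _).
elim=> {n s t} [n s -> _|n s u t st su _ IH e s0|n s a u t st _ IH e s0].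
- exact: walk_refl.
- by apply: (walk_inert st su); apply: (IH e); apply: sim_trans (sim_sym su) s0.
case: (sim_half s0 st) => [[ea u0]|[ts [t' [p [st' _]]]]]; last first.
  by case: ts p st' => [|x ts] /=; [move=> _ /step_nil|case=> /step_nil].
rewrite ea in st; apply: (walk_inert st _ (IH e u0)).
exact: sim_trans s0 (sim_sym u0).
Qed.

(** An optimal walk transported to the other side ends in a process bisimilar to the empty one, from
    which inert moves finish at no cost. *)
Lemma norm_sim s t : sim s t -> norm s = norm t.
Proof.
have le x y : sim x y -> norm x <= norm y.
  move=> /sim_sym yx; have [u w /sim_sym h] := walk_sim yx (norm_walk y).
  by apply: norm_min; rewrite -[norm y]addn0; apply: walk_trans w (walk_of_sim_nil h).
by move=> st; apply/eqP; rewrite eqn_leq !le //; apply: sim_sym.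
Qed.


(** * The norm under prepending, and absorption by a suffix *)

Lemma walk_suffix n s u :
  walk n (s ++ u) [::] -> exists k m, [/\ n = k + m, walk k (s ++ u) u & walk m u [::]].
Proof.
suff h m x y : walk m x y -> y = [::] -> forall s, x = s ++ u ->
    exists k l, [/\ m = k + l, walk k x u & walk l u [::]].
  by move=> w; apply: h w (erefl _) _ (erefl _).
elim=> {m x y s} [m x -> [|//] ux|m x z y st xz w IH ye [|A s] ex|m x a z y st w IH ye [|A s] ex].
- by exists 0, m; rewrite ux -[u]/([::] ++ u) -ux; split=> //; apply: walk_refl.
- rewrite ye in w; exists 0, m; split=> //; first by rewrite ex; apply: walk_refl.
  by move: st xz; rewrite ex => st xz; apply: (walk_inert st xz).
- rewrite ex in st; have [//|s' _ ez] := step_catI st.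
  have [k [l [-> w1 w2]]] := IH ye _ ez; exists k, l; split=> //.
  by rewrite -ex in st; apply: (walk_inert st).
- rewrite ye in w; exists 0, m.+1; split=> //; first by rewrite ex; apply: walk_refl.
  by move: st; rewrite ex => st; apply: (walk_step st).
- rewrite ex in st; have [//|s' _ ez] := step_catI st.
  have [k [l [-> w1 w2]]] := IH ye _ ez; exists k.+1, l; split=> //.
  by rewrite -ex in st; apply: (walk_step st).
Qed.

(** Every walk from [s ++ u] to the empty string passes through [u]; cutting an optimal one there
    leaves an optimal walk from [u]. *)
Lemma norm_cat_walk s u : exists2 k, walk k (s ++ u) u & norm (s ++ u) = k + norm u.
Proof.
have [k [m [e w1 w2]]] := walk_suffix (norm_walk (s ++ u)).
exists k => //; apply/eqP; rewrite eqn_leq (norm_le_walk w1) e leq_add2l.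
exact: norm_min.
Qed.

Lemma leq_norm_cat s u : norm u <= norm (s ++ u).
Proof. by have [k _ ->] := norm_cat_walk s u; rewrite leq_addl. Qed.

(** With equal norms the walk down to [u] has no counted move, so it stays inside one class. *)
Lemma norm_cat_sim s u : norm (s ++ u) = norm u -> sim (s ++ u) u.
Proof.
have [k w ->] := norm_cat_walk s u => /(canRL (addnK _)).
by rewrite subnn => k0; rewrite k0 in w; apply: walk0_sim.
Qed.

Lemma sim_cat_suffix s t u : sim (s ++ t ++ u) u -> sim (t ++ u) u.
Proof.
move/norm_sim => e; apply: norm_cat_sim; apply/eqP.
by rewrite eqn_leq leq_norm_cat -[in X in _ <= X]e leq_norm_cat.
Qed.

Lemma sim_absorbP s u : sim (s ++ u) u <-> (forall X, X \in s -> sim (X :: u) u).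
Proof.
elim: s => [|A s IH]; first by split=> // _; apply: sim_refl.
split=> [h X|h].
  have su : sim (s ++ u) u by apply: (@sim_cat_suffix [:: A]).
  rewrite inE => /orP[/eqP->|]; last by apply: IH.1.
  exact: sim_trans (sim_sym (sim_cons A su)) h.
apply: sim_trans (sim_cons A (IH.2 _)) (h A _); last by rewrite inE eqxx.
by move=> X Xs; apply: h; rewrite inE Xs orbT.
Qed.

(* A move from above the suffix can only be matched through the suffix itself
   when everything above it is absorbed. *)
Lemma sim_change_suffix u v s t :
  (forall X, sim (X :: u) u <-> sim (X :: v) v) ->
  sim (s ++ u) (t ++ u) -> sim (s ++ v) (t ++ v).
Proof.
move=> uv st.
pose B x y := sim x y \/ exists s t, [/\ x = s ++ v, y = t ++ v & sim (s ++ u) (t ++ u)].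
apply: (@sim_coind B); last by right; exists s, t.
  move=> x y [/sim_sym|[x' [y' [-> -> /sim_sym]]]]; first by left.
  by move=> h; right; exists y', x'.
have absv x : sim (x ++ u) u -> sim (x ++ v) v.
  by move/sim_absorbP => h; apply/sim_absorbP => X /h /uv.
move=> {s t st} x0 y0 [xy|[x [y [-> -> xy]]]] a x' stx.
  by apply: (@matched_mono sim B _ _ _ _ (sim_half xy stx)); left.
case: (excluded_middle_informative (sim (x ++ u) u)) => xu.
  (* If [u] absorbs [x], it absorbs [y] too, and absorption passes from [u] to [v] letter by
     letter. *)
  have xyv : sim (x ++ v) (y ++ v).
    apply: sim_trans (absv _ xu) (sim_sym (absv _ _)).
    exact: sim_trans (sim_sym xy) xu.
  by apply: (@matched_mono sim B _ _ _ _ (sim_half xyv stx)); left.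
have [e|x1 st1 ->] := step_catI stx; first by case: xu; rewrite e; apply: sim_refl.
case: (sim_half xy (step_cat u st1)) => [[-> h]|[ts [t' [p [st2 [h hs]]]]]].
  by left; split=> //; right; exists x1, y.
have [|us [y1 [ets p' st' et]]] := taupath_catI p st2.
  rewrite inE => /orP[/eqP e|/hs //]; by case: xu; rewrite [X in sim _ X]e.
right; exists [seq z ++ v | z <- us], (y1 ++ v); do !split.
- exact: taupath_cat.
- by rewrite (last_map (cat^~ v)); apply: step_cat.
- by right; exists x1, y1; rewrite -et.
- move=> _ /mapP[z zus ->]; right; exists x, z; split=> //.
  by apply: hs; rewrite ets; apply: map_f.
Qed.

(** The norm equation makes the walk optimal, so before each counted move the norm exceeds that of
    [w] and the match cannot descend into [w]. *)
Lemma walk_match_prefix k x z w e :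
  walk k x z -> norm x = k + norm z -> norm w <= norm z ->
  sim x (e ++ w) -> exists e', sim z (e' ++ w).
Proof.
move=> wk; elim: k x z / wk e => [k x|k x y z st xy _ IH|k x a y z st wk IH] e nx nw xe.
- by exists e.
- by apply: (IH e) => //; [rewrite -(norm_sim xy)|apply: sim_trans (sim_sym xy) xe].
have ny : norm y = k + norm z.
  have := norm_le_walk (walk_step st (walk_refl 0 y)).
  rewrite nx add1n addSn ltnS => h; apply/eqP; rewrite eqn_leq h andbT.
  exact: norm_le_walk wk.
case: (sim_half xe st) => [[_ h]|[ts [t' [p [st2 [h hs]]]]]]; first exact: IH h.
have xw : ~ sim x w.
  by move/norm_sim; rewrite nx addSn => e'; move: nw; rewrite -e' ltnNge leq_addl.
have [|us [y1 [_ _ _ et]]] := taupath_catI p st2.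
  rewrite inE => /orP[/eqP e'|/hs //]; by case: xw; rewrite [X in sim _ X]e'.
by apply: (IH y1) => //; rewrite -et.
Qed.

Lemma sim_cat_cover s1 u s2 w :
  sim (s1 ++ w) (s2 ++ u) -> norm w <= norm u -> exists e, sim (e ++ w) u.
Proof.
move=> /sim_sym h nw; have [k wk nk] := norm_cat_walk s2 u.
by have [e /sim_sym he] := walk_match_prefix wk nk nw h; exists e.
Qed.
End BranchingBisimilarity.

(** * Redundancy-free strings and dependence on [Rset] alone *)

Section Canonical.
Variables (d : Order.disp_t) (V : finOrderType d) (Act : finType) (tau : Act).
Variable (R : seq (V * Act * seq V)).
Hypothesis Rnormed : normed R.

Local Notation sim := (bisimilar tau R).
Local Notation Rset := (Rset tau R).
Local Notation redfree := (redfree tau R).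
Local Notation cand := (cand tau R).
Local Notation best := (best tau R).
Local Notation norm := (norm tau Rnormed).
Implicit Types (s t u v w : seq V) (A X Y : V).

Lemma in_Rset X u : X \in Rset u <-> sim (X :: u) u.
Proof. by rewrite inE; split=> /pboolP. Qed.

Lemma Rset_sim_cat u v s t :
  Rset u = Rset v -> sim (s ++ u) (t ++ u) -> sim (s ++ v) (t ++ v).
Proof. by move=> e; apply: sim_change_suffix => // X; rewrite -!in_Rset e. Qed.

Lemma sim_Rset u v : sim u v -> Rset u = Rset v.
Proof.
move=> h; apply/setP => X; apply/idP/idP => /in_Rset hX; apply/in_Rset.
  exact: sim_trans (sim_trans (sim_cons X (sim_sym h)) hX) h.
exact: sim_trans (sim_trans (sim_cons X h) hX) (sim_sym h).
Qed.

(** Hence the target state of a transition does not depend on the chosen representative. *)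
Lemma Rset_cat u v s : Rset u = Rset v -> Rset (s ++ u) = Rset (s ++ v).
Proof.
move=> e; apply/setP => X; apply/idP/idP => /in_Rset hX; apply/in_Rset.
  exact: (@Rset_sim_cat u v (X :: s)).
exact: (@Rset_sim_cat v u (X :: s)).
Qed.

Lemma redfree_nil u : redfree [::] u.
Proof. by case=> [[|? ?]] [? [? []]]. Qed.

Lemma redfree_cons X s u :
  redfree (X :: s) u <-> ~ sim (X :: s ++ u) (s ++ u) /\ redfree s u.
Proof.
split=> [h|[h1 h2] [[|Y l] [Z [b [e hs]]]]].
- split=> [hs|[l [Y [b [e hs]]]]]; apply: h; first by exists [::], X, s.
  by exists (X :: l), Y, b; rewrite e.
- by apply: h1; case: e => -> ->.
- by apply: h2; case: e => _ ->; exists l, Z, b.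
Qed.

Lemma redfree_cat s t u : redfree (s ++ t) u <-> redfree s (t ++ u) /\ redfree t u.
Proof.
elim: s => [|X s IH] /=; first by split=> [|[]//]; split=> //; apply: redfree_nil.
by rewrite !redfree_cons IH catA; tauto.
Qed.

Lemma Rset_redfree u v s : Rset u = Rset v -> redfree s u -> redfree s v.
Proof.
move=> e h [l [X [b [es hs]]]]; apply: h; exists l, X, b; split=> //.
exact: (@Rset_sim_cat v u (X :: b)).
Qed.

Lemma redfree_exists s u : exists2 t, redfree t u & sim (t ++ u) (s ++ u).
Proof.
elim: s => [|X s [t ht hs]]; first by exists [::]; [apply: redfree_nil|apply: sim_refl].
case: (excluded_middle_informative (sim (X :: t ++ u) (t ++ u))) => h.
  by exists t => //; apply: sim_trans (sim_sym h) (sim_cons X hs).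
by exists (X :: t); [apply/redfree_cons|apply: sim_cons].
Qed.

(** Each letter of a redundancy-free string strictly raises the norm, since equal norms would mean
    absorption. *)
Lemma redfree_norm s u : redfree s u -> size s + norm u <= norm (s ++ u).
Proof.
elim: s => [//|X s IH] /redfree_cons [h /IH le] /=.
rewrite addSn; apply: leq_ltn_trans le _.
rewrite ltn_neqAle (@leq_norm_cat _ _ _ _ _ [:: X]) andbT.
by apply/eqP => e; apply: h; apply: (@norm_cat_sim _ _ _ _ Rnormed [:: X]).
Qed.

Lemma Rset_cand u v A s : Rset u = Rset v -> cand u A s -> cand v A s.
Proof.
move=> e [h rs]; split; last exact: Rset_redfree rs.
exact: (@Rset_sim_cat u v s [:: A]).
Qed.

Lemma Rset_best u v A s : Rset u = Rset v -> best u A s -> best v A s.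
Proof.
move=> e [h [mx mn]]; split; first exact: Rset_cand h.
by split=> t /(Rset_cand (esym e)); [apply: mx|apply: mn].
Qed.

(** * Lexicographic minimality and the outputs of the transducer *)

Lemma lexlt_rcons s t X : size s = size t -> lexlt s t -> lexlt (rcons s X) (rcons t X).
Proof.
move=> e [[]|[s' [t' [g [A [B [-> [-> AB]]]]]]]]; first by rewrite e ltnn.
by right; exists s', t', (rcons g X), A, B; rewrite -!cats1 -!catA.
Qed.

(** [lexlt] compares from the right, so the least last letter is chosen first and induction chooses
    the rest. *)
Lemma lexlt_min n (P : seq V -> Prop) :
  (exists2 s, P s & size s = n) ->
  exists2 s, P s /\ size s = n & forall t, P t -> size t = n -> t <> s -> lexlt s t.
Proof.
elim: n P => [|n IH] P [s Ps sn].
  by exists s => // t _ /size0nil-> []; rewrite (size0nil sn).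
pose Q X := pbool (exists2 t, P (rcons t X) & size t = n).
case: (lastP s) Ps sn => // s0 X0 Ps; rewrite size_rcons => -[sn].
have Q0 : Q X0 by apply/pboolP; exists s0.
case: (Order.TotalTheory.arg_minP id Q0) => X /pboolP QX minX.
have [t [Pt tn] mint] := IH (fun t => P (rcons t X)) QX.
exists (rcons t X); first by rewrite size_rcons tn.
move=> t1; case: (lastP t1) => // t2 Y Pt2; rewrite size_rcons => -[t2n] ne.
case: (eqVneq Y X) => [eY|neY].
  rewrite eY in Pt2 ne *; apply: lexlt_rcons; first by rewrite tn t2n.
  by apply: mint => // e; apply: ne; rewrite e.
right; exists t, t2, [::], X, Y; rewrite !cats1; do !split=> //.
rewrite Order.POrderTheory.lt_neqAle eq_sym neY; apply: minX.
by apply/pboolP; exists t2.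
Qed.

Lemma best_exists u A : exists s, best u A s.
Proof.
have [s0 rs0 ss0] := redfree_exists [:: A] u.
pose P n := pbool (exists2 s, cand u A s & size s = n).
have exP : exists n, P n by exists (size s0); apply/pboolP; exists s0.
have ubP n : P n -> n <= norm (A :: u).
  move=> /pboolP[s [ss rs] <-]; rewrite -(norm_sim Rnormed ss).
  exact: leq_trans (leq_addr _ _) (redfree_norm rs).
case: (ex_maxnP exP ubP) => n /pboolP exn maxn.
have [s [cs sn] mins] := lexlt_min exn.
exists s; split=> //; split=> [t ct|t ct]; rewrite sn; last exact: mins.
by apply: maxn; apply/pboolP; exists t.
Qed.

Lemma canon_out_best u A : best u A (canon_out tau R u A).
Proof.
rewrite /canon_out; case: excluded_middle_informative => [h|[]]; last exact: best_exists.
exact: proj2_sig.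
Qed.

(** The deciding position carries distinct letters and has equal letters to its right, so it is that
    of [X] and [Y]. *)
Lemma lexlt_single s t X Y :
  X != Y -> lexlt (s ++ X :: t) (s ++ Y :: t) -> (X < Y)%O.
Proof.
move=> XY [[]|[s1 [t1 [g [A [B [e1 [e2 AB]]]]]]]]; first by rewrite !size_cat ltnn.
elim/last_ind: t g e1 e2 => [|t Z IH] g; case: (lastP g) => [|g' Z'].
- by rewrite !cats1 => /rcons_inj[_ ->] /rcons_inj[_ ->].
- rewrite !cats1 -!rcons_cons -!rcons_cat => /rcons_inj[_ eX] /rcons_inj[_ eY].
  by rewrite eX eY eqxx in XY.
- rewrite !cats1 -!rcons_cons -!rcons_cat => /rcons_inj[_ eX] /rcons_inj[_ eY].
  by rewrite -eX -eY Order.POrderTheory.ltxx in AB.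
- rewrite -!rcons_cons -!rcons_cat => /rcons_inj[e1 _] /rcons_inj[e2 _].
  exact: IH e1 e2.
Qed.

Lemma lexlt1 X Y : X != Y -> lexlt [:: X] [:: Y] -> (X < Y)%O.
Proof. exact: (@lexlt_single [::] [::]). Qed.

Lemma cand1 u X Y : sim (X :: u) (Y :: u) -> ~ sim (X :: u) u -> cand u Y [:: X].
Proof. by move=> h nX; split=> //; apply/redfree_cons; split=> //; apply: redfree_nil. Qed.

(** Each letter is a candidate for the other, so distinct letters would have to precede each
    other. *)
Lemma best1_inj u X Y :
  best u X [:: X] -> best u Y [:: Y] -> sim (X :: u) (Y :: u) -> X = Y.
Proof.
move=> [[_ /redfree_cons[nX _]] [_ mX]] [[_ /redfree_cons[nY _]] [_ mY]] XY.
apply/eqP/negPn/negP => ne; have cX := cand1 XY nX.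
have cY := cand1 (sim_sym XY) nY.
have lt1 : (X < Y)%O.
  by apply: lexlt1 => //; apply: mX => // -[e]; rewrite e eqxx in ne.
have : (Y < X)%O.
  rewrite eq_sym in ne.
  by apply: lexlt1 => //; apply: mY => // -[e]; rewrite e eqxx in ne.
by rewrite Order.POrderTheory.lt_gtF.
Qed.

Lemma best1_unique u X s : best u X [:: X] -> best u X s -> s = [:: X].
Proof.
move=> b1 b2.
have sz : size s = 1.
  by apply/eqP; rewrite eqn_leq (b1.2.1 _ b2.1) (b2.2.1 _ b1.1).
case: s sz b2 => [//|Y [|//]] _ b2; congr [:: _]; have YX := b2.1.1.
apply/esym/(best1_inj b1 _ (sim_sym YX)); have [[_ rY] [mx mn]] := b2.
(* Letters bisimilar above [u] have the same candidates, so [[:: Y]] is also best for [Y]. *)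
split; first by split=> //; apply: sim_refl.
by split=> t [ht rt]; [apply: mx|apply: mn]; split=> //; apply: sim_trans ht YX.
Qed.

Lemma canon_out1 u X : best u X [:: X] -> canon_out tau R u X = [:: X].
Proof. by move=> b; apply: (best1_unique b); apply: canon_out_best. Qed.

(** Replacing [X] by a candidate for it yields another candidate for [A], so a better choice for [X]
    would improve the whole string. *)
Lemma best_factor u A s X t :
  best u A (s ++ X :: t) -> best (t ++ u) X [:: X].
Proof.
move=> [[h /redfree_cat[rs /redfree_cons[nX rt]]] [mx mn]].
have subst r : cand (t ++ u) X r -> cand u A (s ++ r ++ t).
  move=> [hr rr]; split.
    by rewrite -!catA; apply: sim_trans h; rewrite -catA; apply: sim_catl.
  apply/redfree_cat; rewrite -catA; split; last exact/redfree_cat.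
  by apply: Rset_redfree rs; apply/sim_Rset/sim_sym.
split; first by apply: cand1 => //; apply: sim_refl.
split=> [r /subst/mx|r cr].
  by rewrite !size_cat /= leq_add2l -add1n leq_add2r.
case: r cr => [//|Y [|//]] cr _ ne; right; exists [::], [::], [::], X, Y.
have neXY : X != Y by apply/eqP => e; apply: ne; rewrite e.
do !split=> //; apply: (@lexlt_single s t) => //.
apply: (mn _ (subst _ cr)); first by rewrite !size_cat.
by move=> /eqP; rewrite eqseq_cat // eqxx /= eqseq_cons eqxx andbT eq_sym (negPf neXY).
Qed.

(** * Runs of the canonical transducer and normal forms *)

Local Notation delta := (deltaC tau R).
Implicit Types q : QC tau R.

Lemma repP q : Rset (rep q) = proj1_sig q.
Proof. by rewrite /rep; case: constructive_indefinite_description. Qed.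

Lemma QC_eq q q' : Rset (rep q) = Rset (rep q') -> q = q'.
Proof.
rewrite !repP; case: q q' => [S hS] [S' hS'] /= e.
by subst S'; rewrite (proof_irrelevance _ hS hS').
Qed.

Lemma rep_mkQ u : Rset (rep (mkQ tau R u)) = Rset u.
Proof. exact: repP. Qed.

Lemma run_cons q A s :
  run delta q (A :: s) = let p := run delta q s in
    (mkQ tau R (A :: rep p.1), canon_out tau R (rep p.1) A ++ p.2).
Proof. by []. Qed.

Lemma run_sound q s :
  Rset (rep (run delta q s).1) = Rset (s ++ rep q) /\
  sim ((run delta q s).2 ++ rep q) (s ++ rep q).
Proof.
elim: s => [|A s [IH1 IH2]]; first by split=> //; apply: sim_refl.
rewrite run_cons /= rep_mkQ; split; first exact: (@Rset_cat _ _ [:: A]).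
rewrite -catA; apply: sim_trans (sim_catl _ IH2) _.
have [[h _] _] := canon_out_best (rep (run delta q s).1) A.
exact: (@Rset_sim_cat _ _ _ [:: A] IH1 h).
Qed.

(** Semantic counterpart of [is_nf], stated over a string instead of a state so that it splits along
    [++] and transports along equal [Rset]. *)
Fixpoint nf u s : Prop :=
  if s is X :: s' then best (s' ++ u) X [:: X] /\ nf u s' else True.

Lemma nf_cat u s t : nf u (s ++ t) <-> nf (t ++ u) s /\ nf u t.
Proof. by elim: s => [|X s IH] /=; rewrite ?IH ?catA; tauto. Qed.

Lemma Rset_nf u v s : Rset u = Rset v -> nf u s -> nf v s.
Proof.
by move=> e; elim: s => //= X s IH [b /IH n]; split=> //; apply: Rset_best b; apply: Rset_cat.
Qed.

Lemma nf_redfree u s : nf u s -> redfree s u.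
Proof.
elim: s => [_|X s IH /= [[[_ /redfree_cons[nX _]] _] /IH rs]]; first exact: redfree_nil.
exact/redfree_cons.
Qed.

Lemma best_nf u A s : best u A s -> nf u s.
Proof.
move=> b; suff h l t : s = l ++ t -> nf u t by apply: (h [::]).
elim: t l => [//|X t IH] l e /=; split; last by apply: (IH (rcons l X)); rewrite cat_rcons.
by rewrite e in b; apply: best_factor b.
Qed.

Lemma nf_run q s : nf (rep q) s -> (run delta q s).2 = s.
Proof.
elim: s => [//|X s IH] [b /IH e]; rewrite run_cons /= e canon_out1 //.
by apply: Rset_best b; rewrite (run_sound q s).1.
Qed.

Lemma nf_is_nf q s : nf (rep q) s -> is_nf delta q s.
Proof.
move=> h; rewrite /is_nf.
set f := fun A p => _; suff -> : foldr f (q, true) s = ((run delta q s).1, true) by [].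
elim: s h => [//|X s IH] [b /IH e]; rewrite run_cons /= e {1}/f /= canon_out1 ?eqxx //.
by apply: Rset_best b; rewrite (run_sound q s).1.
Qed.

(** The new output block is normal above the representative of the state reached, which has the same
    [Rset] as the earlier output above [rep q]. *)
Lemma run_nf q s : nf (rep q) (run delta q s).2.
Proof.
elim: s => [//|A s IH]; rewrite run_cons /=; apply/nf_cat; split=> //.
apply: Rset_nf (best_nf (canon_out_best _ A)).
have [-> h] := run_sound q s.
exact/sim_Rset/sim_sym.
Qed.

Lemma nf_nil_of_sim u s t : nf u (s ++ t) -> sim (s ++ t ++ u) (t ++ u) -> s = [::].
Proof.
move=> /nf_cat[/nf_redfree rs _]; case/lastP: s rs => // s X.
rewrite -cats1 => /redfree_cat[_ /redfree_cons[nX _]] h; case: nX.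
by rewrite -catA in h; apply: (@sim_cat_suffix _ _ _ _ Rnormed s [:: X] (t ++ u)).
Qed.

(* The process on the right can be lowered to Y u without the left one leaving
   its suffix X u, so Y u is covered by some e X u with e redundancy-free; as
   [:: Y] is longest, e is empty. *)
Lemma nf_differ u s1 X s2 Y :
  norm (X :: u) <= norm (Y :: u) ->
  nf u (s1 ++ [:: X]) -> nf u (s2 ++ [:: Y]) ->
  sim (s1 ++ X :: u) (s2 ++ Y :: u) -> X = Y.
Proof.
move=> nXY /nf_cat[_ [bX _]] /nf_cat[_ [bY _]] h.
have [e0 he0] := sim_cat_cover h nXY.
have [e re he] := redfree_exists e0 (X :: u).
have c : cand u Y (e ++ [:: X]).
  split; first by rewrite -catA; apply: sim_trans he he0.
  by apply/redfree_cat; split=> //; exact: bX.1.2.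
have := bY.2.1 _ c; rewrite size_cat addn1; case: e c {re he} => // -[c _] _.
exact: best1_inj bX bY c.
Qed.

(** The strings are compared from the right: the last letters agree by [nf_differ], with the norms
    deciding the roles, and the common letter then joins [u]. *)
Lemma nf_unique u s t : nf u s -> nf u t -> sim (s ++ u) (t ++ u) -> s = t.
Proof.
elim/last_ind: s t u => [|s X IH] t u; case/lastP: t => [|t Y] //.
- move=> _ nt /sim_sym h; symmetry; apply: (@nf_nil_of_sim u _ [::]) => //.
  by rewrite cats0.
- by move=> ns _ h; apply: (@nf_nil_of_sim u _ [::]) => //; rewrite cats0.
rewrite -!cats1 -!catA /= => ns nt h.
have eXY : X = Y.
  case: (leqP (norm (X :: u)) (norm (Y :: u))) => [le|/ltnW le].
    exact: nf_differ le ns nt h.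
  by symmetry; apply: nf_differ le nt ns (sim_sym h).
rewrite -eXY in nt h *; congr (_ ++ _); move: ns nt => /nf_cat[ns _] /nf_cat[nt _].
exact: IH ns nt h.
Qed.

(** * From equality of outputs to long moves *)

Lemma Tout_eq q s t : sim (s ++ rep q) (t ++ rep q) <-> Tout delta q s = Tout delta q t.
Proof.
have [_ hs] := run_sound q s; have [_ ht] := run_sound q t; split=> h.
  apply: nf_unique (run_nf q s) (run_nf q t) _.
  exact: sim_trans hs (sim_trans h (sim_sym ht)).
by apply: sim_trans (sim_sym hs) _; rewrite -/(Tout _ _ _) h.
Qed.

(* Any u with [Rset u = q] may replace the representative chosen in [rep q];
   this matters for the initial state, whose representative need not be empty. *)
Lemma long_move_sim q u s t a r :
  Rset (rep q) = Rset u -> sim (s ++ u) (t ++ u) ->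
  (u = [::] \/ ~ sim (t ++ u) u) ->
  long_move tau R delta q s a r -> long_move tau R delta q t a r.
Proof.
move=> qu st nu.
have TE x y : sim (x ++ u) (y ++ u) <-> Tout delta q x = Tout delta q y.
  by rewrite -Tout_eq; split; apply: Rset_sim_cat.
have eT : Tout delta q s = Tout delta q t by apply/TE.
case=> [[-> ->]|[ts [s' [p [hts [sts <-]]]]]]; first by left.
(* The path keeps its output constant, so its end is still bisimilar to [t] above [u]. *)
have lt : sim (last s ts ++ u) (t ++ u).
  apply/TE; have := mem_last s ts; rewrite inE => /orP[/eqP->//|/hts->//].
case: (sim_half lt (step_cat u sts)) => [[-> h]|[us [t' [pu [stu [h hus]]]]]].
  by left; split=> //; apply/TE.
(* A visit to a nonempty [u] would make [t ++ u] bisimilar to [u], against [nu]. *)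
have [|ws [t1 [eus p' st' et]]] := taupath_catI pu stu.
  case: nu => // nu; rewrite inE => /orP[/eqP e|uus]; case: nu.
    by rewrite [X in sim _ X]e; apply: sim_refl.
  exact: sim_trans (sim_sym lt) (hus _ uus).
right; exists ws, t1; do !split=> //; last by apply/TE/sim_sym; rewrite -et.
move=> w wws; apply/TE; apply: sim_trans lt; apply: sim_sym; apply: hus.
by rewrite eus; apply: map_f.
Qed.

Lemma approx_sim q u s t :
  Rset (rep q) = Rset u -> sim (s ++ u) (t ++ u) ->
  (u = [::] \/ ~ sim (t ++ u) u) -> approx tau R delta q s t.
Proof.
move=> qu st nu a r; split; first exact: long_move_sim qu st nu.
apply: (long_move_sim qu (sim_sym st)).
by case: nu => [|nu]; [left|right=> h; apply: nu; apply: sim_trans (sim_sym st) h].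
Qed.

(** * Normal-form outputs and consistency *)

Lemma deltaC_nfc : nfc delta.
Proof.
move=> q A; split; first exact/nf_is_nf/run_nf.
move=> q' s [<- es].
have b := canon_out_best (rep q) A; rewrite {}es in b.
rewrite [run _ _ _]surjective_pairing (nf_run (best_nf b)); congr pair.
(* Reading the output leads to the same state as reading [A], because the two are bisimilar above
   [rep q]. *)
by apply: QC_eq; rewrite rep_mkQ (run_sound q s).1; apply/sim_Rset/b.1.1.
Qed.

Lemma deltaC_consistent : consistent tau R delta (q0C tau R).
Proof.
have q0 : Rset (rep (q0C tau R)) = Rset [::] by apply: rep_mkQ.
split=> [A hA|]; last split=> [q A hA|q A C hAC hC].
(* The empty string also represents the initial state, and leaves no suffix to descend into. *)
- apply: (approx_sim (u := [::])) => //; last by left.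
  by apply: (Rset_sim_cat q0); apply/Tout_eq.
- have [_ h] := run_sound q [:: A].
  apply: (approx_sim (u := rep q)) => //; first exact: sim_sym.
  (* If the output were absorbed by [rep q], so would be [A], and the output would be empty. *)
  right=> h'; apply: hA; apply/(Tout_eq q [:: A] [::]).
  exact: sim_trans (sim_sym h) h'.
- apply: (approx_sim (u := rep q)) => //; first by apply/Tout_eq; rewrite hAC hC.
  by right=> /(Tout_eq q [:: C] [::]); rewrite hC.
Qed.
End Canonical.

Theorem theorem4p7 (d : Order.disp_t) (V : finOrderType d) (Act : finType)
  (tau : Act) (R : seq (V * Act * seq V)) :
  normed R ->
  nfc (deltaC tau R) /\ consistent tau R (deltaC tau R) (q0C tau R).
Proof. by move=> Rnormed; split; [apply: deltaC_nfc|apply: deltaC_consistent]. Qed.
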